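(* Let $k\ge1$. The parametric form of the boundary $\Gamma^k_{\mathrm{crit}}$ is $$\Gamma^k_{\mathrm{crit}}=\{(\gamma_0(w),\gamma_1(w)): w\in(w_{\min},w_{\max})\},$$ where $$\gamma_1(w)=w-\frac{P_k(w)\left(P_k(w)+P_k(1-w)\right)}{P_k'(1-w)P_k(w)+P_k'(w)P_k(1-w)},$$ $\gamma_0(w)=\gamma_1(1-w)$, $w_{\min}\in(0,1/2)$ solves $\gamma_0(w_{\min})=0$, and $w_{\max}=1-w_{\min}$. Here $P_k'$ denotes the derivative of $P_k$ with respect to its argument (so $P_k'(1-w)$ is $P_k'$ evaluated at $1-w$). Furthermore, $\gamma_0(1/2)=\gamma_1(1/2)=\gamma_k^*$, where $$\gamma_k^*=\frac12+\frac1{4k}-\frac{2^{2k}}{4k\binom{2k}{k}}$$ is the point at which $\Gamma^k_{\mathrm{crit}}$ intersects the line $\gamma_0=\gamma_1$ (i.e. the intersection point is $(\gamma_k^*,\gamma_k^* )$).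
   Context: Let $\Gamma=\{(\gamma_0,\gamma_1)\in(0,1)^2:0<\gamma_0+\gamma_1<1\}$. For an integer $k\ge1$, let $P_k(x)=\sum_{r=k+1}^{2k}\binom{2k}{r}x^r(1-x)^{2k-r}$ and, for $(\gamma_0,\gamma_1)\in\Gamma$, let $\Delta_k(x)=(1-x-\gamma_0)P_k(x)-(x-\gamma_1)P_k(1-x)$ on $\mathcal{S}=[\gamma_1,1-\gamma_0]$. $\Gamma^k_{\mathrm{crit}}$ is the set of $(\gamma_0,\gamma_1)\in\Gamma$ for which the real roots of $\Delta_k$ in $\mathcal{S}$ are either one simple root and one double root, or one triple root. *)

(* Defs.v *)
From HB Require Import structures.
From mathcomp Require Import all_boot all_order all_algebra.
From mathcomp Require Import all_classical all_reals.
Set Implicit Arguments.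
Unset Strict Implicit.
Unset Printing Implicit Defensive.
Import Order.TTheory GRing.Theory Num.Theory.
Local Open Scope classical_set_scope.
Local Open Scope ring_scope.

Definition Gamma (R : realType) : set (R * R) :=
  [set g | [/\ 0 < g.1 < 1, 0 < g.2 < 1 & 0 < g.1 + g.2 < 1]].

Definition P (R : realType) (k : nat) : {poly R} :=
  \sum_(k.+1 <= r < (2 * k).+1)
     'C(2 * k, r)%:R *: ('X^r * (1 - 'X) ^+ (2 * k - r)).

(* [P R k \Po (1 - 'X)] is the polynomial x |-> P_k(1 - x). *)
Definition Delta (R : realType) (k : nat) (g0 g1 : R) : {poly R} :=
  (1 - 'X - g0%:P) * P R k - ('X - g1%:P) * (P R k \Po (1 - 'X)).

Definition one_simple_one_double (R : realType) (p : {poly R}) (S : set R) :=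
  exists x y : R,
    [/\ x != y, S x /\ S y, mup x p = 1%N, mup y p = 2%N &
        forall z : R, S z -> root p z -> z = x \/ z = y].

Definition one_triple (R : realType) (p : {poly R}) (S : set R) :=
  exists x : R,
    [/\ S x, mup x p = 3%N & forall z : R, S z -> root p z -> z = x].

Definition Gamma_crit (R : realType) (k : nat) : set (R * R) :=
  [set g | Gamma g /\
     let p := Delta k g.1 g.2 in
     let S := [set x : R | g.2 <= x <= 1 - g.1] in
     one_simple_one_double p S \/ one_triple p S].

(* The denominator is positive for every w in the open interval (0, 1), so the
   convention x / 0 = 0 plays no role there. *)
Definition gamma1 (R : realType) (k : nat) (w : R) : R :=
  let p := P R k in
  w - (p.[w] * (p.[w] + p.[1 - w])) /
      (p^`().[1 - w] * p.[w] + p^`().[w] * p.[1 - w]).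

Definition gamma0 (R : realType) (k : nat) (w : R) : R := gamma1 k (1 - w).

Definition gamma_star (R : realType) (k : nat) : R :=
  1 / 2 + 1 / (4 * k)%:R - 2 ^+ (2 * k) / ((4 * k)%:R * 'C(2 * k, k)%:R).

Definition is_wmin (R : realType) (k : nat) (w : R) : Prop :=
  0 < w < 1 / 2 /\ gamma0 k w = 0.

(* Main.v *)
Require Import Defs.
From HB Require Import structures.
From mathcomp Require Import all_boot all_order all_algebra.
From mathcomp Require Import all_classical all_reals.
From mathcomp Require Import normedtype derive realfun.
From mathcomp Require Import ring lra zify.
Set Implicit Arguments.
Unset Strict Implicit.
Unset Printing Implicit Defensive.
Import Order.TTheory GRing.Theory Num.Theory.
Import numFieldNormedType.Exports.
Local Open Scope classical_set_scope.
Local Open Scope ring_scope.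

(** Put Q(x) = P(1 - x), D = P + Q and phi = P / D.  Since
      Delta = D * (g1 + (1 - g0 - g1) * phi - x),
    the roots of Delta are the points where a line meets the graph of phi, and
    everything follows from phi being a sigmoid.

    The derivative of the binomial tail telescopes to a single monomial,
    P' = c x^k (1 - x)^(k-1) with c = k * binomial(2k, k) (deriv_P).  Hence
    phi' = W / D^2, where the Wronskian W = P' Q - P Q' factors as
    c (x (1 - x))^(k-1) (x Q + (1 - x) P), and the last factor has derivative
    Q - P, which is positive on (0, 1/2).  There W increases and D decreases, so
    phi' increases on (0, 1/2); it is symmetric about 1/2 (WD2_lt, W_sym, D_sym).

    A double root of Delta at w is a linear system for (g0, g1) whose only
    solution is (gamma0(w), gamma1(w)) (double_rootP); the line is then the
    tangent of phi at w.  If w < 1/2, convexity followed by concavity makes the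
    tangent meet the graph at exactly one other point, to the right of 1 - w
    and transversally (simple_root_lt), while the second derivative of Delta at w
    does not vanish (deriv2_neq0).  The case w > 1/2 is its mirror image under
    x -> 1 - x.  If w = 1/2 the second derivative vanishes by symmetry, the third
    one does not (deriv3_half_neq0), and there is no other root.  Thus the pair
    (gamma0(w), gamma1(w)) is critical as soon as it lies in Gamma, and every
    critical pair is of this form.

    Finally gamma0 = T / W and gamma1 = U / W with T = (1 - x) W - Q D and
    U = x W - P D, which are exchanged by x -> 1 - x.  As
    T' = (1 - x) W' - 2 Q D' and U' = x W' - 2 P D' are positive on (0, 1/2),
    U is positive on (0, 1/2] while T increases from -1 to T(1/2) > 0, and
    wmin is its zero.  Likewise T - U increases to 0 on (0, 1/2), so the
    curve meets the diagonal only at w = 1/2. *)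

(** * Quotients, Wronskians and reflections of polynomials *)

(** If the Wronskian of A and D is positive then A / D increases; the conclusion
    is written without division. *)
Lemma poly_ratio_lt (R : realType) (A D : {poly R}) (x y : R) :
  x < y -> (forall z, x <= z <= y -> 0 < D.[z]) ->
  (forall z, x < z < y -> 0 < (A^`() * D - A * D^`()).[z]) ->
  A.[x] * D.[y] < A.[y] * D.[x].
Proof.
move=> xy Dgt0 Ngt0.
pose f : R -> R := horner A * (fun z => (D.[z])^-1).
pose df z := (A^`() * D - A * D^`()).[z] / D.[z] ^+ 2.
have fdf z : x <= z <= y -> is_derive z 1 f (df z).
  move=> zxy; have D0 : D.[z] != 0 by rewrite gt_eqF ?Dgt0.
  have dD : is_derive z 1 (fun t => (D.[t])^-1) (- D.[z] ^- 2 *: D^`().[z]).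
    exact: is_deriveV.
  apply: trigger_derive.
  rewrite /df !hornerE /GRing.scale /=; by field.
have [c cxy fE] : exists2 c, c \in `]x, y[%R & f y - f x = df c * (y - x).
  apply: MVT => // [z|].
    by rewrite in_itv/= => /andP[xz zy]; apply: fdf; rewrite !ltW.
  apply: derivable_within_continuous => z.
  by rewrite in_itv/= => /fdf[].
move: cxy; rewrite in_itv/= => cxy.
have dfc : 0 < df c.
  by rewrite divr_gt0 ?Ngt0// exprn_gt0// Dgt0//; case/andP: cxy => /ltW-> /ltW->.
have : f x < f y by rewrite -subr_gt0 fE mulr_gt0// subr_gt0.
rewrite /f /GRing.mul /=.
by rewrite ltr_pdivrMr ?Dgt0 ?lexx ?ltW// mulrAC ltr_pdivlMr ?Dgt0 ?lexx ?ltW.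
Qed.

Lemma poly_ratio_gt (R : realType) (A D : {poly R}) (x y : R) :
  x < y -> (forall z, x <= z <= y -> 0 < D.[z]) ->
  (forall z, x < z < y -> (A^`() * D - A * D^`()).[z] < 0) ->
  A.[y] * D.[x] < A.[x] * D.[y].
Proof.
move=> xy D0 N0; rewrite -ltrN2 -!mulNr -!hornerN poly_ratio_lt// => z zxy.
by rewrite derivN !mulNr -opprD hornerN oppr_gt0 N0.
Qed.

Lemma poly_mono_lt (R : realType) (A : {poly R}) (x y : R) :
  x < y -> (forall z, x < z < y -> 0 < A^`().[z]) -> A.[x] < A.[y].
Proof.
move=> xy A'; have := @poly_ratio_lt R A 1%:P x y xy.
rewrite !hornerC !mulr1; apply=> z; first by rewrite hornerC ltr01.
by move=> zxy; rewrite derivC mulr0 subr0 A'.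
Qed.

Lemma deriv_wronskian (R : comNzRingType) (A D : {poly R}) :
  (A^`() * D - A * D^`())^`() = A^`()^`() * D - A * D^`()^`().
Proof. by rewrite derivB !derivM; ring. Qed.

Lemma deriv2_wronskian (R : comNzRingType) (A D : {poly R}) :
  (A^`() * D - A * D^`())^`()^`() =
  A^`()^`()^`() * D + A^`()^`() * D^`() - A^`() * D^`()^`() - A * D^`()^`()^`().
Proof. by rewrite deriv_wronskian derivB !derivM; ring. Qed.

Lemma comp1BK (R : comNzRingType) (A : {poly R}) : A \Po (1 - 'X) \Po (1 - 'X) = A.
Proof.
rewrite -comp_polyA comp_polyB comp_polyC comp_polyX opprB addrC subrK.
by rewrite comp_polyXr.
Qed.

Lemma deriv_comp1B (R : comNzRingType) (A : {poly R}) :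
  (A \Po (1 - 'X))^`() = - (A^`() \Po (1 - 'X)).
Proof. by rewrite deriv_comp derivB derivC derivX sub0r mulrN1. Qed.

(** * Root multiplicities read off the derivatives *)

Lemma root_factor (R : fieldType) (p : {poly R}) (x : R) : p.[x] = 0 ->
  exists2 q, p = q * ('X - x%:P) & q.[x] = p^`().[x].
Proof.
move=> /rootP/factor_theorem[q ->]; exists q => //.
by rewrite derivM derivXsubC !hornerE subrr mulr0 add0r.
Qed.

Lemma mup1_deriv (R : fieldType) (p : {poly R}) (x : R) :
  p.[x] = 0 -> p^`().[x] != 0 -> mup x p = 1%N.
Proof.
move=> /root_factor[q -> <-] qx; rewrite mupMr; last by rewrite rootE.
by rewrite -['X - _]expr1 mup_XsubCX eqxx.
Qed.

Lemma mup_mulXsubC (R : fieldType) (q : {poly R}) (x : R) :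
  q != 0 -> mup x (q * ('X - x%:P)) = (mup x q).+1.
Proof.
move=> q0; rewrite mupM ?polyXsubC_eq0//.
by rewrite -['X - _]expr1 mup_XsubCX eqxx addn1.
Qed.

Lemma mup2_deriv (R : numFieldType) (p : {poly R}) (x : R) :
  p.[x] = 0 -> p^`().[x] = 0 -> p^`()^`().[x] != 0 -> mup x p = 2%N.
Proof.
move=> /root_factor[q -> <-] qx0.
rewrite derivM derivXsubC mulr1 derivD derivM derivXsubC !hornerE subrr.
rewrite mulr0 add0r => q'x.
have q'x0 : q^`().[x] != 0 by apply: contraNneq q'x => ->; rewrite addr0.
rewrite mup_mulXsubC ?(mup1_deriv qx0)//.
by apply: contraNneq q'x0 => ->; rewrite deriv0 horner0.
Qed.

Lemma mup3_deriv (R : numFieldType) (p : {poly R}) (x : R) :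
  p.[x] = 0 -> p^`().[x] = 0 -> p^`()^`().[x] = 0 ->
  p^`()^`()^`().[x] != 0 -> mup x p = 3%N.
Proof.
move=> /root_factor[q -> <-] qx0.
rewrite derivM derivXsubC mulr1 derivD derivM derivXsubC !hornerE subrr.
rewrite mulr0 add0r => q'x.
have q'x0 : q^`().[x] = 0.
  by move: q'x; rewrite -mulr2n => /eqP; rewrite mulrn_eq0/= => /eqP.
rewrite !poly.derivE/= !hornerE subrr mulr0 add0r => q''x.
have q''x0 : q^`()^`().[x] != 0.
  by apply: contraNneq q''x => ->; rewrite !addr0.
rewrite mup_mulXsubC ?(mup2_deriv qx0 q'x0)//.
by apply: contraNneq q''x0 => ->; rewrite !deriv0 horner0.
Qed.

Lemma mup_ge2_deriv (R : fieldType) (p : {poly R}) (x : R) :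
  (2 <= mup x p)%N -> p.[x] = 0 /\ p^`().[x] = 0.
Proof.
have [->|p0] := eqVneq p 0; first by rewrite deriv0 horner0.
rewrite mup_geq// => /dvdpP[q ->].
rewrite expr2 mulrA derivM derivXsubC mulr1 hornerD !hornerM hornerXsubC subrr.
by rewrite !mulr0 addr0.
Qed.

(** * The binomial tail and its derivative *)

(** The reflected polynomial x |-> P(1 - x). *)
Definition Qp (R : realType) (k : nat) : {poly R} := P R k \Po (1 - 'X).

(** The denominator of the sigmoid P / (P + Q). *)
Definition Dp (R : realType) (k : nat) : {poly R} := P R k + Qp R k.

(** The Wronskian of Q and P, numerator of the derivative of P / (P + Q). *)
Definition Wp (R : realType) (k : nat) : {poly R} :=
  (P R k)^`() * Qp R k - P R k * (Qp R k)^`().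

(** The leading constant of the derivative of P. *)
Definition coefP (R : realType) (k : nat) : R := k%:R * 'C(2 * k, k)%:R.

Section BinomialTail.
Context {R : realType} (k : nat).
Hypothesis k0 : (0 < k)%N.
Implicit Types x : R.
Local Notation p := (P R k).
Local Notation q := (Qp R k).
Local Notation d := (Dp R k).
Local Notation W := (Wp R k).
Local Notation c := (coefP R k).

Lemma coefP_gt0 : 0 < c.
Proof. by rewrite mulr_gt0 ?ltr0n// bin_gt0 mul2n -addnn leq_addr. Qed.

(** The Bernstein polynomial of index r and degree n, without truncation: for
    r > n it vanishes because its binomial coefficient does. *)
Definition bterm (n r : nat) : {poly R} :=
  'C(n, r)%:R *: ('X^r * (1 - 'X) ^+ (n - r)).

Lemma deriv_bterm (n r : nat) :
  (bterm n.+1 r.+1)^`() = n.+1%:R *: (bterm n r - bterm n r.+1).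
Proof.
have e1 : 'C(n.+1, r.+1)%:R * r.+1%:R = n.+1%:R * 'C(n, r)%:R :> R.
  by rewrite mulrC -!natrM -mul_bin_diag.
have e2 : 'C(n.+1, r.+1)%:R * (n - r)%:R = n.+1%:R * 'C(n, r.+1)%:R :> R.
  by rewrite mulrC -!natrM (mul_bin_down n.+1) subSS.
rewrite /bterm subSS derivZ derivM derivXn deriv_exp derivB derivC derivX sub0r /=.
rewrite mulN1r mulNrn mulrN mulrnAl mulrnAr -subnS.
by rewrite !scalerBr !scalerA -e1 -e2 -!scalerA !scaler_nat.
Qed.

Lemma deriv_P : p^`() = c *: ('X^k * (1 - 'X) ^+ k.-1).
Proof.
have [N eN] : exists N, (2 * k)%N = N.+1 by exists (2 * k).-1; lia.
rewrite /P eN big_add1 /= raddf_sum /=.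
under eq_bigr => r _ do rewrite -/(bterm N.+1 r.+1) deriv_bterm.
rewrite -scaler_sumr.
under eq_bigr => r _ do rewrite -opprB.
rewrite sumrN telescope_sumr; last by lia.
rewrite opprB {2}/bterm bin_small// scale0r subr0 /bterm.
rewrite scalerA /coefP eN -!natrM.
have -> : (N - k = k.-1)%N by lia.
have -> : (N.+1 * 'C(N, k) = k * 'C(N.+1, k))%N.
  have -> : 'C(N, k) = 'C(N, k.-1).
    by rewrite -bin_sub; [congr 'C(_, _); lia|lia].
  by rewrite (mul_bin_diag N.+1) prednK.
by [].
Qed.

Lemma bterm_comp (n r : nat) : (r <= n)%N ->
  bterm n r \Po (1 - 'X) = bterm n (n - r).
Proof.
move=> rn; rewrite /bterm comp_polyZ comp_polyM !rmorphXn/= comp_polyB comp_polyC comp_polyX.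
by rewrite subKn// bin_sub// mulrC opprB addrC subrK.
Qed.

(** The terms of P and Q together make up the binomial expansion of
    ((1 - x) + x)^(2k), except for the central one. *)
Lemma Dp_central : d = 1 - 'C(2 * k, k)%:R *: ('X * (1 - 'X)) ^+ k.
Proof.
have e1 : \sum_(0 <= r < (2 * k).+1) bterm (2 * k) r = 1.
  transitivity ((1 - 'X + 'X : {poly R}) ^+ (2 * k)); last by rewrite subrK expr1n.
  rewrite exprDn big_mkord.
  by apply: eq_bigr => r _; rewrite /bterm scaler_nat mulrC.
have e2 : q = \sum_(0 <= r < k) bterm (2 * k) r.
  rewrite /Qp /P raddf_sum /= -(add0n k.+1) big_addn big_nat_rev /=.
  have -> : ((2 * k).+1 - k.+1 = k)%N by lia.
  apply: eq_big_nat => r /andP[_ rk].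
  by rewrite add0n -/(bterm _ _) bterm_comp; [congr bterm; lia|lia].
move: e1; rewrite (big_cat_nat _ (n := k)) //=; last by lia.
rewrite (big_ltn (n := (2 * k).+1)) /=; last by lia.
rewrite -/(P R k) {2}/bterm exprMn /Dp e2; have -> : (2 * k - k = k)%N by lia.
by move=> e; apply: (canRL (addrK _)); rewrite -[RHS]e; ring.
Qed.

End BinomialTail.

(** * Shape of the sigmoid P / (P + Q) *)

Section Shape.
Context {R : realType} (k : nat).
Hypothesis k0 : (0 < k)%N.
Implicit Types x y z : R.
Local Notation p := (P R k).
Local Notation q := (Qp R k).
Local Notation d := (Dp R k).
Local Notation W := (Wp R k).
Local Notation c := (coefP R k).

Lemma hornerQ x : q.[x] = p.[1 - x].
Proof. by rewrite /Qp horner_comp !hornerE. Qed.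

Lemma hornerQ1 x : q.[1 - x] = p.[x].
Proof. by rewrite hornerQ; congr (p.[_]); ring. Qed.

Lemma D_sym x : d.[1 - x] = d.[x].
Proof. by rewrite /Dp !hornerD hornerQ1 hornerQ addrC. Qed.

(** The factor (x (1 - x))^(k-1) common to the derivatives of P, Q and D. *)
Definition Sp : {poly R} := ('X * (1 - 'X)) ^+ k.-1.

Lemma deriv_P_factor : p^`() = c *: ('X * Sp).
Proof. by rewrite (deriv_P k0) /Sp exprMn mulrA -exprS prednK. Qed.

Lemma deriv_QE : q^`() = - (c *: ((1 - 'X) * Sp)).
Proof.
rewrite /Qp deriv_comp1B deriv_P_factor /Sp comp_polyZ comp_polyM rmorphXn/=.
rewrite comp_polyM comp_polyB comp_polyC comp_polyX.
by rewrite (_ : 1 - (1 - 'X) = 'X :> {poly R}); [rewrite ['X * _]mulrC|ring].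
Qed.

Lemma deriv_DE : d^`() = c *: ((2%:P * 'X - 1) * Sp).
Proof.
rewrite /Dp derivD deriv_P_factor deriv_QE -scalerN -scalerDr.
by congr (_ *: _); ring.
Qed.

(** The remaining factor of W; its derivative is Q - P. *)
Definition Ep : {poly R} := 'X * q + (1 - 'X) * p.

Lemma WE : W = c *: (Sp * Ep).
Proof.
rewrite /Wp deriv_P_factor deriv_QE /Ep mulrN opprK -scalerAl -scalerAr -scalerDr.
by congr (_ *: _); ring.
Qed.

Lemma deriv_Ep : Ep^`() = q - p.
Proof.
rewrite /Ep derivD !derivM derivB derivX derivC deriv_P_factor deriv_QE -!mul_polyC.
by ring.
Qed.

Lemma horner_deriv_Sp x :
  Sp^`().[x] = (1 - 2 * x) * (x * (1 - x)) ^+ k.-2 *+ k.-1.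
Proof.
rewrite /Sp deriv_exp derivM derivB derivX derivC hornerMn; congr (_ *+ _).
by rewrite !hornerE /=; ring.
Qed.

Lemma Sp_gt0 x : 0 < x < 1 -> 0 < Sp.[x].
Proof.
by move=> /andP[x0 x1]; rewrite /Sp !hornerE exprn_gt0// mulr_gt0// subr_gt0.
Qed.

Lemma horner_P_0 : p.[0] = 0.
Proof.
rewrite /P horner_sum big_nat_cond big1// => r /andP[/andP[kr _] _].
rewrite hornerZ hornerM hornerXn expr0n gtn_eqF ?(leq_ltn_trans (leq0n k) kr)//.
by rewrite mul0r mulr0.
Qed.

Lemma horner_P_1 : p.[1] = 1.
Proof.
have := congr1 (horner^~ 0) (@Dp_central R k k0).
rewrite /Dp hornerD horner_P_0 hornerQ subr0 add0r !hornerE => ->.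
by rewrite expr0n gtn_eqF//= mulr0 subr0.
Qed.

Lemma P_lt x y : 0 <= x -> x < y -> y <= 1 -> p.[x] < p.[y].
Proof.
move=> x0 xy y1; apply: poly_mono_lt => // z /andP[xz zy].
have z0 : 0 < z by lra.
have z1 : 0 < z < 1 by rewrite z0/=; lra.
rewrite deriv_P_factor hornerZ hornerM hornerX pmulr_rgt0 ?coefP_gt0//.
by rewrite pmulr_rgt0// Sp_gt0.
Qed.

Lemma P_gt0 x : 0 < x <= 1 -> 0 < p.[x].
Proof. by move=> /andP[x0 x1]; rewrite -horner_P_0 P_lt. Qed.

Lemma P_ge0 x : 0 <= x <= 1 -> 0 <= p.[x].
Proof.
rewrite le_eqVlt => /andP[/predU1P[<- _|x0 x1]]; first by rewrite horner_P_0.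
by rewrite ltW// P_gt0// x0.
Qed.

Lemma Q_gt0 x : 0 <= x < 1 -> 0 < q.[x].
Proof. by move=> /andP[x0 x1]; rewrite hornerQ P_gt0//; lra. Qed.

Lemma D_gt0 x : 0 <= x <= 1 -> 0 < d.[x].
Proof.
move=> /andP[x0 x1]; rewrite /Dp hornerD.
have [->|x_neq1] := eqVneq x 1.
  by rewrite hornerQ subrr horner_P_0 horner_P_1 addr0.
by rewrite ltr_wpDl ?P_ge0 ?x0// Q_gt0 ?x0//= lt_neqAle x_neq1.
Qed.

Lemma P_lt_Q x : 0 <= x < 1 / 2 -> p.[x] < q.[x].
Proof. by move=> /andP[x0 x1]; rewrite hornerQ P_lt//; lra. Qed.

Lemma dD_lt0 x : 0 < x < 1 / 2 -> d^`().[x] < 0.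
Proof.
move=> /andP[x0 x1]; rewrite deriv_DE hornerZ hornerM pmulr_rlt0 ?coefP_gt0//.
by rewrite pmulr_llt0 ?Sp_gt0 ?hornerE//=; lra.
Qed.

Lemma Ep_gt0 x : 0 < x < 1 -> 0 < Ep.[x].
Proof.
move=> /andP[x0 x1]; rewrite /Ep hornerD !hornerM hornerX hornerD hornerN hornerC hornerX.
by rewrite addr_gt0// mulr_gt0 ?subr_gt0// ?Q_gt0 ?P_gt0// ?x0 ltW.
Qed.

Lemma W_gt0 x : 0 < x < 1 -> 0 < W.[x].
Proof.
move=> x01; rewrite WE hornerZ hornerM pmulr_rgt0 ?coefP_gt0//.
by rewrite pmulr_rgt0 ?Sp_gt0 ?Ep_gt0.
Qed.

Lemma dW_gt0 x : 0 < x < 1 / 2 -> 0 < W^`().[x].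
Proof.
move=> /andP[x0 x1]; have x01 : 0 < x < 1 by rewrite x0/=; lra.
rewrite WE derivZ derivM deriv_Ep hornerZ pmulr_rgt0 ?coefP_gt0//.
rewrite hornerD !hornerM horner_deriv_Sp ltr_wpDl//.
  rewrite mulr_ge0 ?(ltW (Ep_gt0 _))// mulrn_wge0// mulr_ge0//; first lra.
  by rewrite exprn_ge0// mulr_ge0//; lra.
by rewrite mulr_gt0 ?Sp_gt0// hornerD hornerN subr_gt0 P_lt_Q// x1 ltW.
Qed.

Lemma W_sym x : W.[1 - x] = W.[x].
Proof.
rewrite /Wp !hornerE /Qp !deriv_comp1B !hornerE !horner_comp !hornerE.
by rewrite (_ : 1 - (1 - x) = x); ring.
Qed.

(** The slope W / D^2 of the sigmoid strictly increases on [0, 1/2]. *)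
Lemma WD2_lt x y : 0 <= x -> x < y -> y <= 1 / 2 ->
  W.[x] * d.[y] ^+ 2 < W.[y] * d.[x] ^+ 2.
Proof.
move=> x0 xy y1; rewrite -!horner_exp; apply: poly_ratio_lt => // z /andP[xz zy].
  by rewrite horner_exp exprn_gt0// D_gt0//; lra.
have z01 : 0 < z < 1 / 2 by lra.
have -> : W^`() * d ^+ 2 - W * (d ^+ 2)^`() = d * (W^`() * d - 2%:P * W * d^`()).
  by rewrite deriv_exp; ring.
rewrite hornerM mulr_gt0 ?D_gt0//; first lra.
rewrite hornerD hornerN !hornerM hornerC.
have := dW_gt0 z01; have := dD_lt0 z01.
have z01' : 0 < z < 1 by lra.
have z01'' : 0 <= z <= 1 by lra.
have := W_gt0 z01'; have := D_gt0 z01''.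
by move=> ? ? ? ?; nra.
Qed.

(** Numerator of gamma1 over W. *)
Definition Up : {poly R} := 'X * W - p * d.

(** Numerator of gamma0 over W. *)
Definition Tp : {poly R} := (1 - 'X) * W - q * d.

Lemma hornerU x : Up.[x] = x * W.[x] - p.[x] * d.[x].
Proof. by rewrite /Up hornerD hornerN !hornerM hornerX. Qed.

Lemma hornerT x : Tp.[x] = (1 - x) * W.[x] - q.[x] * d.[x].
Proof. by rewrite /Tp hornerD hornerN !hornerM hornerD hornerN hornerC hornerX. Qed.

Lemma T_sym x : Tp.[1 - x] = Up.[x].
Proof. by rewrite hornerT hornerU D_sym W_sym hornerQ1; ring. Qed.

Lemma U_sym x : Up.[1 - x] = Tp.[x].
Proof. by rewrite -T_sym; congr (_.[_]); ring. Qed.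

Lemma deriv_Up : Up^`() = 'X * W^`() - 2%:P * p * d^`().
Proof.
rewrite /Up derivB !derivM derivX {1}/Wp /Dp !derivD; ring.
Qed.

Lemma deriv_Tp : Tp^`() = (1 - 'X) * W^`() - 2%:P * q * d^`().
Proof.
rewrite /Tp derivB !derivM derivB derivX derivC {1}/Wp /Dp !derivD; ring.
Qed.

Lemma U_gt0 x : 0 < x <= 1 / 2 -> 0 < Up.[x].
Proof.
move=> /andP[x0 x1].
have <- : Up.[0] = 0 by rewrite hornerU horner_P_0 !mul0r subr0.
apply: poly_mono_lt => // z /andP[z0 zx].
rewrite deriv_Up hornerD hornerN !hornerM hornerC hornerX.
have z01 : 0 < z < 1 / 2 by lra.
have z01' : 0 < z <= 1 by lra.
have := dW_gt0 z01; have := dD_lt0 z01; have := P_gt0 z01'.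
by move=> ? ? ?; nra.
Qed.

Lemma T_lt x y : 0 <= x -> x < y -> y <= 1 / 2 -> Tp.[x] < Tp.[y].
Proof.
move=> x0 xy y1; apply: poly_mono_lt => // z /andP[xz zy].
rewrite deriv_Tp hornerD hornerN !hornerM !hornerC hornerD hornerN hornerC hornerX.
have z01 : 0 < z < 1 / 2 by lra.
have z01' : 0 <= z < 1 by lra.
have := dW_gt0 z01; have := dD_lt0 z01; have := Q_gt0 z01'.
by move=> ? ? ?; nra.
Qed.

Lemma T_lt_U x : 0 <= x < 1 / 2 -> Tp.[x] < Up.[x].
Proof.
move=> /andP[x0 x1]; rewrite -subr_lt0.
have <- : (Tp - Up).[1 / 2] = 0.
  by rewrite hornerD hornerN -T_sym (_ : 1 - 1 / 2 = 1 / 2 :> R) ?subrr//; field.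
have -> : Tp.[x] - Up.[x] = (Tp - Up).[x] by rewrite hornerD hornerN.
apply: poly_mono_lt => // z /andP[xz zx].
rewrite (_ : _^`() = (1 - 2%:P * 'X) * W^`() - 2%:P * (q - p) * d^`()); last first.
  by rewrite derivB deriv_Up deriv_Tp; ring.
rewrite hornerD hornerN !hornerM !hornerD !hornerN !hornerM !hornerC hornerX.
have z01 : 0 < z < 1 / 2 by lra.
have z01' : 0 <= z < 1 / 2 by lra.
have := dW_gt0 z01; have := dD_lt0 z01; have := P_lt_Q z01'.
by move=> ? ? ?; nra.
Qed.

Lemma gamma1E w : 0 < w < 1 -> gamma1 k w = Up.[w] / W.[w].
Proof.
move=> w01; have W0 := W_gt0 w01.
rewrite /gamma1 /= -hornerQ.
have -> : p^`().[1 - w] * p.[w] + p^`().[w] * q.[w] = W.[w].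
  by rewrite /Wp /Qp deriv_comp1B !hornerE !horner_comp !hornerE; ring.
rewrite hornerU {1}/Dp hornerD; field.
by rewrite gt_eqF.
Qed.

Lemma gamma0E w : 0 < w < 1 -> gamma0 k w = Tp.[w] / W.[w].
Proof.
by move=> w01; rewrite /gamma0 gamma1E ?U_sym ?W_sym//; lra.
Qed.

End Shape.

(** * Roots of Delta in the presence of a double root *)

Section DoubleRoot.
Context {R : realType} (k : nat).
Hypothesis k0 : (0 < k)%N.
Implicit Types x y z w a b : R.
Local Notation p := (P R k).
Local Notation q := (Qp R k).
Local Notation d := (Dp R k).
Local Notation W := (Wp R k).
Local Notation T := (@Tp R k).
Local Notation U := (@Up R k).

Lemma hornerDelta a b x :
  (Delta k a b).[x] = (1 - x - a) * p.[x] - (x - b) * q.[x].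
Proof.
by rewrite /Delta -/(Qp R k) hornerD hornerN !hornerM !hornerD !hornerN !hornerC hornerX.
Qed.

(** Reflection about 1/2 exchanges the two parameters. *)
Lemma Delta_swap a b x : (Delta k a b).[1 - x] = - (Delta k b a).[x].
Proof. by rewrite !hornerDelta hornerQ1 (hornerQ k x); ring. Qed.

Lemma horner_deriv_Delta a b x : (Delta k a b)^`().[x] =
  (1 - x - a) * p^`().[x] - (x - b) * q^`().[x] - (p.[x] + q.[x]).
Proof.
rewrite /Delta -/(Qp R k) derivB !derivM !derivB !derivC derivX.
rewrite !(hornerD, hornerN, hornerM, hornerC, hornerX).
ring.
Qed.

(** Up to the factor D^2 this is the derivative of Delta / D, that is, the slope
    of the sigmoid rescaled by 1 - a - b, minus 1. *)
Lemma Delta_wronskian a b : let A := Delta k a b in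
  A^`() * d - A * d^`() = (1 - a - b)%:P * W - d ^+ 2.
Proof.
rewrite /Delta /= -/(Qp R k) derivB !derivM !derivB !derivC derivX /Wp /Dp derivD.
by rewrite !polyCB polyC1; ring.
Qed.

Lemma horner_wronskian a b x : let A := Delta k a b in
  (A^`() * d - A * d^`()).[x] = (1 - a - b) * W.[x] - d.[x] ^+ 2.
Proof.
by rewrite /= Delta_wronskian hornerD hornerN hornerM hornerC horner_exp.
Qed.

Lemma hornerDp x : d.[x] = p.[x] + q.[x]. Proof. exact: hornerD. Qed.

Lemma hornerWp x : W.[x] = p^`().[x] * q.[x] - p.[x] * q^`().[x].
Proof. by rewrite /Wp hornerD hornerN !hornerM. Qed.

(** Vanishing of Delta and of its derivative at w is a linear system in (a, b)
    of determinant W(w). *)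
Lemma double_rootP a b w : 0 < w < 1 ->
  (Delta k a b).[w] = 0 /\ (Delta k a b)^`().[w] = 0 <->
  a = T.[w] / W.[w] /\ b = U.[w] / W.[w].
Proof.
move=> w01; have W0 := W_gt0 k0 w01.
have p0 : 0 < p.[w] by apply: P_gt0 => //; lra.
have q0 : 0 < q.[w] by apply: Q_gt0 => //; lra.
have WN0 : W.[w] != 0 by rewrite gt_eqF.
rewrite hornerDelta horner_deriv_Delta hornerT hornerU hornerDp.
split=> [[e1 e2]|[ea eb]].
  split; apply: (canRL (mulfK WN0)); rewrite hornerWp.
    have : q.[w] * ((1 - w - a) * p^`().[w] - (w - b) * q^`().[w] - (p.[w] + q.[w])) = 0.
      by rewrite e2 mulr0.
    have : q^`().[w] * ((1 - w - a) * p.[w] - (w - b) * q.[w]) = 0 by rewrite e1 mulr0.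
    by move=> *; lra.
  have : p.[w] * ((1 - w - a) * p^`().[w] - (w - b) * q^`().[w] - (p.[w] + q.[w])) = 0.
    by rewrite e2 mulr0.
  have : p^`().[w] * ((1 - w - a) * p.[w] - (w - b) * q.[w]) = 0 by rewrite e1 mulr0.
  by move=> *; lra.
have ea' : 1 - w - a = q.[w] * (p.[w] + q.[w]) / W.[w] by rewrite ea; field.
have eb' : w - b = p.[w] * (p.[w] + q.[w]) / W.[w] by rewrite eb; field.
rewrite ea' eb'; split; first by ring.
have -> : q.[w] * (p.[w] + q.[w]) / W.[w] * p^`().[w]
  - p.[w] * (p.[w] + q.[w]) / W.[w] * q^`().[w] =
  (p.[w] + q.[w]) * (W.[w] / W.[w]) by rewrite {3}hornerWp; ring.
by rewrite divff// mulr1 subrr.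
Qed.

Lemma dD_sym x : d^`().[1 - x] = - d^`().[x].
Proof.
have e : d \Po (1 - 'X) = d.
  by rewrite /Dp /Qp comp_polyD comp1BK addrC.
by rewrite -[in RHS]e deriv_comp1B hornerN horner_comp !hornerE opprK.
Qed.

Lemma dW_sym x : W^`().[1 - x] = - W^`().[x].
Proof.
have e : W \Po (1 - 'X) = W.
  rewrite /Wp comp_polyB !comp_polyM {2}/Qp comp1BK /Qp !deriv_comp1B !raddfN /=.
  by rewrite comp1BK; ring.
by rewrite -[in RHS]e deriv_comp1B hornerN horner_comp !hornerE opprK.
Qed.

Section AtDoubleRoot.
Variables (a b w : R).
Hypothesis w01 : 0 < w < 1.
Local Notation A := (Delta k a b).
Hypothesis Aw : A.[w] = 0.
Hypothesis dAw : A^`().[w] = 0.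

Let w01' : 0 <= w <= 1. Proof. by case/andP: w01 => *; rewrite !ltW. Qed.

(** The line with parameters a and b is tangent to the sigmoid at w. *)
Lemma slope_at_double_root : (1 - a - b) * W.[w] = d.[w] ^+ 2.
Proof.
have /= := horner_wronskian a b w.
rewrite hornerD hornerN !hornerM Aw dAw; lra.
Qed.

Lemma slope_gt0 : 0 < 1 - a - b.
Proof.
by rewrite -(pmulr_lgt0 _ (W_gt0 k0 w01)) slope_at_double_root exprn_gt0// D_gt0.
Qed.

Lemma deriv2_at_double_root :
  A^`()^`().[w] * d.[w] = (1 - a - b) * W^`().[w] - 2 * d.[w] * d^`().[w].
Proof.
have := congr1 (fun B => B^`().[w]) (Delta_wronskian a b).
rewrite /= deriv_wronskian hornerD hornerN !hornerM Aw mul0r subr0 => ->.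
rewrite derivB derivM derivC mul0r add0r deriv_exp.
by rewrite hornerD hornerN hornerM hornerC hornerMn hornerM; ring.
Qed.

(** Away from 1/2 the sigmoid has nonzero curvature at w. *)
Lemma deriv2_neq0 : w != 1 / 2 -> A^`()^`().[w] != 0.
Proof.
move=> w12; have D0 := D_gt0 k0 w01'; have s0 := slope_gt0.
suff : A^`()^`().[w] * d.[w] != 0 by rewrite mulf_eq0 negb_or => /andP[].
rewrite deriv2_at_double_root.
move: w12; rewrite neq_lt => /orP[] w12.
  have w02 : 0 < w < 1 / 2 by case/andP: w01 => -> _.
  have := dW_gt0 k0 w02; have := dD_lt0 k0 w02 => *.
  by rewrite gt_eqF//; nra.
have w02 : 0 < 1 - w < 1 / 2 by move: w01; lra.
have := dW_gt0 k0 w02; have := dD_lt0 k0 w02; rewrite dD_sym dW_sym => *.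
by rewrite lt_eqF//; nra.
Qed.

Lemma wronskian_lt0_left x : w <= 1 / 2 -> 0 <= x < w ->
  (A^`() * d - A * d^`()).[x] < 0.
Proof.
move=> w12 /andP[x0 xw]; rewrite horner_wronskian subr_lt0.
rewrite -(ltr_pM2l (W_gt0 k0 w01)) mulrCA mulrA slope_at_double_root.
by rewrite mulrC WD2_lt.
Qed.

Lemma wronskian_sym x :
  (A^`() * d - A * d^`()).[1 - x] = (A^`() * d - A * d^`()).[x].
Proof.
by rewrite !horner_wronskian W_sym D_sym.
Qed.

Lemma wronskian_gt0_mid x : w < x < 1 - w -> 0 < (A^`() * d - A * d^`()).[x].
Proof.
wlog x12 : x / x <= 1 / 2 => [hw xw|].
  have [/hw->//|x12] := leP x (1 / 2).
  by rewrite -wronskian_sym hw//; move: w01; lra.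
move=> /andP[wx _]; rewrite horner_wronskian subr_gt0.
rewrite -(ltr_pM2l (W_gt0 k0 w01)) [ltRHS]mulrCA mulrA slope_at_double_root.
by rewrite [ltRHS]mulrC WD2_lt//; move: w01; lra.
Qed.

Lemma wronskian_lt0_right x : w <= 1 / 2 -> 1 - w < x <= 1 ->
  (A^`() * d - A * d^`()).[x] < 0.
Proof.
by move=> w12 hx; rewrite -wronskian_sym wronskian_lt0_left//; move: w01; lra.
Qed.

Lemma Delta_gt0_left x : w <= 1 / 2 -> 0 <= x < w -> 0 < A.[x].
Proof.
move=> w12 /andP[x0 xw].
rewrite -(pmulr_lgt0 _ (D_gt0 k0 w01')) -(mul0r d.[x]) -{1}Aw.
apply: poly_ratio_gt => // z hz; first by apply: D_gt0 => //; move: w01; lra.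
by apply: wronskian_lt0_left => //; move: w01; lra.
Qed.

Lemma Delta_gt0_mid x : w < x <= 1 - w -> 0 < A.[x].
Proof.
move=> /andP[wx xw].
rewrite -(pmulr_lgt0 _ (D_gt0 k0 w01')) -(mul0r d.[x]) -{1}Aw.
apply: poly_ratio_lt => // z hz; first by apply: D_gt0 => //; move: w01; lra.
by apply: wronskian_gt0_mid => //; move: w01; lra.
Qed.

Lemma Delta_ratio_gt_right x y : w <= 1 / 2 -> 1 - w <= x -> x < y -> y <= 1 ->
  A.[y] * d.[x] < A.[x] * d.[y].
Proof.
move=> w12 wx xy y1; apply: poly_ratio_gt => // z hz.
  by apply: D_gt0 => //; move: w01; lra.
by apply: wronskian_lt0_right => //; move: w01; lra.
Qed.

End AtDoubleRoot.

Lemma Delta_end_lt0 a b : 0 < a < 1 -> 0 < b -> 0 < 1 - a - b ->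
  (Delta k a b).[1 - a] < 0.
Proof.
move=> a01 b0 ab; rewrite hornerDelta hornerQ1.
rewrite (_ : 1 - (1 - a) - a = 0); last by ring.
rewrite mul0r sub0r oppr_lt0 mulr_gt0//.
by apply: P_gt0 => //; lra.
Qed.

(** The tangent at a point w of the convex part meets the graph over [b, 1 - a]
    exactly once more, to the right of 1 - w and transversally. *)
Lemma simple_root_lt a b w : 0 < w < 1 / 2 -> 0 < a < 1 -> 0 < b <= w ->
  (Delta k a b).[w] = 0 -> (Delta k a b)^`().[w] = 0 ->
  exists y, [/\ y != w, b <= y <= 1 - a, (Delta k a b).[y] = 0,
    (Delta k a b)^`().[y] != 0 &
    forall z, b <= z <= 1 - a -> (Delta k a b).[z] = 0 -> z = y \/ z = w].
Proof.
move=> w02 a01 /andP[b0 bw] Aw dAw.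
have w01 : 0 < w < 1 by lra.
have w12 : w <= 1 / 2 by lra.
have s0 := slope_gt0 w01 Aw dAw.
have Aa := Delta_end_lt0 a01 b0 s0.
(* Delta is nonnegative on [0, 1 - w] and negative at 1 - a. *)
have wa : 1 - w < 1 - a.
  rewrite ltNge; apply/negP => h.
  have [h1|h1|h1] := ltgtP (1 - a) w.
  - suff : 0 < (Delta k a b).[1 - a] by lra.
    by apply: (Delta_gt0_left w01 Aw dAw w12); lra.
  - suff : 0 < (Delta k a b).[1 - a] by lra.
    by apply: (Delta_gt0_mid w01 Aw dAw); lra.
  - by move: Aa; rewrite h1 Aw ltxx.
have A1w : 0 < (Delta k a b).[1 - w].
  by apply: (Delta_gt0_mid w01 Aw dAw); lra.
have [|y /andP[y1 y2] /rootP] := @poly_ivt _ (- Delta k a b) (1 - w) (1 - a) (ltW wa).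
  by rewrite !hornerN oppr_le0 oppr_ge0 !ltW.
rewrite hornerN => /eqP; rewrite oppr_eq0 => /eqP Ay.
have y1' : 1 - w < y.
  by rewrite lt_neqAle y1 andbT; apply: contraTneq A1w => ->; rewrite Ay ltxx.
exists y; split => //; [by rewrite gt_eqF//; lra|lra| |].
  have yI : 1 - w < y <= 1 by lra.
  have := wronskian_lt0_right w01 Aw dAw w12 yI.
  rewrite hornerD hornerN !hornerM Ay mul0r subr0 => h.
  by apply: contraTneq h => ->; rewrite mul0r ltxx.
move=> z hz Az.
have z0 : 0 <= z <= 1 by lra.
have y0 : 0 <= y <= 1 by lra.
have [zw|zw|->] := ltgtP z w; last by right.
  suff : 0 < (Delta k a b).[z] by lra.
  by apply: (Delta_gt0_left w01 Aw dAw w12); lra.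
left; have [zw'|zw'] := leP z (1 - w).
  suff : 0 < (Delta k a b).[z] by lra.
  by apply: (Delta_gt0_mid w01 Aw dAw); lra.
have [zy|zy|//] := ltgtP z y.
  have := Delta_ratio_gt_right w01 Aw dAw w12 (ltW zw') zy (proj2 (andP y0)).
  by rewrite Az Ay !mul0r ltxx.
have := Delta_ratio_gt_right w01 Aw dAw w12 y1 zy (proj2 (andP z0)).
by rewrite Az Ay !mul0r ltxx.
Qed.

End DoubleRoot.

(** * Critical pairs *)

Section Critical.
Context {R : realType} (k : nat).
Hypothesis k0 : (0 < k)%N.
Implicit Types x y z w a b : R.
Local Notation p := (P R k).
Local Notation q := (Qp R k).
Local Notation d := (Dp R k).
Local Notation W := (Wp R k).
Local Notation T := (@Tp R k).
Local Notation U := (@Up R k).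
Local Notation S := (@Sp R k).

Lemma half1B : 1 - 1 / 2 = 1 / 2 :> R. Proof. by field. Qed.

Lemma dD_half : d^`().[1 / 2] = 0.
Proof. by have := dD_sym k (1 / 2 : R); rewrite half1B; lra. Qed.

Lemma dW_half : W^`().[1 / 2] = 0.
Proof. by have := dW_sym k (1 / 2 : R); rewrite half1B; lra. Qed.

Lemma Q_half : q.[1 / 2] = p.[1 / 2].
Proof. by rewrite hornerQ half1B. Qed.

Lemma half01 : 0 < (1 / 2 : R) < 1. Proof. lra. Qed.

Lemma ddD_half_gt0 : 0 < d^`()^`().[1 / 2].
Proof.
rewrite (deriv_DE k0) derivZ derivM derivB derivC hornerZ pmulr_rgt0 ?coefP_gt0//.
rewrite hornerD !hornerM [X in _ + X * _](_ : _ = 0); last first.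
  by rewrite hornerD hornerN hornerM !hornerC hornerX; field.
rewrite mul0r addr0 pmulr_lgt0 ?(Sp_gt0 k half01)//.
by rewrite derivM derivC derivX mul0r add0r mulr1 subr0 hornerC ltr0n.
Qed.

Lemma ddS_half_le0 : S^`()^`().[1 / 2] <= 0.
Proof.
have -> : S^`() = ((1 - 2%:P * 'X) * ('X * (1 - 'X)) ^+ k.-2) *+ k.-1.
  rewrite /Sp deriv_exp derivM derivB derivX derivC; congr (_ *+ _); ring.
rewrite derivMn derivM hornerMn hornerD !hornerM [X in _ + X * _](_ : _ = 0); last first.
  by rewrite hornerD hornerN hornerM !hornerC hornerX; field.
rewrite mul0r addr0 -oppr_ge0 -mulNrn mulrn_wge0// -mulNr mulr_ge0//.
  by rewrite derivB derivM !derivC derivX mul0r !add0r mulr1 hornerN hornerC opprK ler0n.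
rewrite horner_exp exprn_ge0// hornerM hornerD hornerN hornerC hornerX; lra.
Qed.

Lemma ddW_half_le0 : W^`()^`().[1 / 2] <= 0.
Proof.
rewrite (WE k0) !derivZ derivM derivD !derivM (deriv_Ep k0) hornerZ.
rewrite pmulr_rle0 ?coefP_gt0// derivB !hornerD !hornerM !hornerD !hornerN Q_half.
rewrite subrr mulr0 addr0 add0r (deriv_QE k0) (deriv_P_factor k0).
rewrite hornerN !hornerZ !hornerM !hornerD !hornerN !hornerC !hornerX.
have S0 : 0 < S.[1 / 2] := Sp_gt0 k half01.
have E0 : 0 < (@Ep R k).[1 / 2] := Ep_gt0 k0 half01.
have c0 : 0 < coefP R k := coefP_gt0 k0.
have h1 := mulr_le0_ge0 ddS_half_le0 (ltW E0).
have h2 := mulr_gt0 c0 (mulr_gt0 S0 S0).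
move: h1; rewrite /Ep hornerD !hornerM hornerD hornerN hornerC hornerX => h1.
lra.
Qed.

Section TripleRoot.
Variables a b : R.
Local Notation A := (Delta k a b).
Hypothesis A0 : A.[1 / 2] = 0.
Hypothesis dA0 : A^`().[1 / 2] = 0.

Lemma deriv2_half : A^`()^`().[1 / 2] = 0.
Proof.
have D0 : 0 < d.[1 / 2] by apply: (D_gt0 k0); lra.
have := deriv2_at_double_root A0.
rewrite dW_half dD_half !mulr0 subr0 => /eqP.
by rewrite mulf_eq0 (gt_eqF D0) orbF => /eqP.
Qed.

(** At the inflection point 1/2 the contact has order exactly three: there the
    Wronskian of Delta and D has second derivative Delta''' D, and it is negative
    because W'' <= 0 and D'' > 0. *)
Lemma deriv3_half_neq0 : A^`()^`()^`().[1 / 2] != 0.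
Proof.
have D0 : 0 < d.[1 / 2] by apply: (D_gt0 k0); lra.
have s0 := slope_gt0 k0 half01 A0 dA0.
have e : A^`()^`()^`() * d + A^`()^`() * d^`() - A^`() * d^`()^`() - A * d^`()^`()^`()
       = (1 - a - b)%:P * W^`()^`() - 2%:P * (d^`() * d^`() + d * d^`()^`()).
  transitivity ((A^`() * d - A * d^`())^`()^`()).
    by rewrite deriv2_wronskian.
  rewrite Delta_wronskian.
  have -> : ((1 - a - b)%:P * W - d ^+ 2)^`() =
      (1 - a - b)%:P * W^`() - 2%:P * (d * d^`()).
    by rewrite derivB derivM derivC mul0r add0r deriv_exp; ring.
  by rewrite derivB !(derivM _%:P) !derivC !mul0r !add0r derivM.
(* Evaluation rules for these two shapes only: rewriting with hornerD would
   also split Delta and D, which are sums up to unfolding. *)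
have hl (B1 B2 B3 B4 : {poly R}) x :
    (B1 + B2 - B3 - B4).[x] = B1.[x] + B2.[x] - B3.[x] - B4.[x].
  by rewrite !(hornerD, hornerN).
have hr (s : R) (B1 B2 B3 : {poly R}) x :
    (s%:P * B1 - 2%:P * (B2 + B3)).[x] = s * B1.[x] - 2 * (B2.[x] + B3.[x]).
  by rewrite !(hornerD, hornerN, hornerM, hornerC).
have := congr1 (horner^~ (1 / 2)) e.
rewrite /= hl hr !hornerM A0 dA0 dD_half !(mul0r, mulr0, addr0, subr0, add0r) => h.
have := ddW_half_le0; have := ddD_half_gt0 => e1 e2.
by apply: contraTneq s0 => e3; move: h; rewrite e3; nra.
Qed.

End TripleRoot.

Lemma deriv_Delta_swap a b x : (Delta k a b)^`().[1 - x] = (Delta k b a)^`().[x].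
Proof.
have -> : Delta k b a = - (Delta k a b \Po (1 - 'X)).
  rewrite /Delta comp_polyB !comp_polyM comp1BK !comp_polyB !comp_polyC comp_polyX.
  by ring.
by rewrite derivN deriv_comp1B opprK horner_comp !hornerE.
Qed.

(** In both patterns of roots, some root in S has multiplicity at least two. *)
Lemma critical_param a b : @Gamma_crit R k (a, b) ->
  exists2 w, 0 < w < 1 & [/\ a = gamma0 k w, b = gamma1 k w, 0 < T.[w] & 0 < U.[w]].
Proof.
move=> [[/= a01 b01 ab01] h].
have [w [wS mw]] : exists w, b <= w <= 1 - a /\ (2 <= mup w (Delta k a b))%N.
  by case: h => [[x [y [_ [_ yS] _ my _]]]|[x [xS mx _]]];
    [exists y; rewrite my|exists x; rewrite mx].
have w01 : 0 < w < 1 by lra.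
have W0 := W_gt0 k0 w01.
have [ea eb] := (double_rootP k0 a b w01).1 (mup_ge2_deriv mw).
exists w => //; split; rewrite ?gamma0E ?gamma1E//.
  by rewrite -(pmulr_lgt0 _ (x := W.[w]^-1)) ?invr_gt0// -ea; lra.
by rewrite -(pmulr_lgt0 _ (x := W.[w]^-1)) ?invr_gt0// -eb; lra.
Qed.

Lemma param_critical w : 0 < w < 1 -> 0 < T.[w] -> 0 < U.[w] ->
  @Gamma_crit R k (gamma0 k w, gamma1 k w).
Proof.
move=> w01 T0 U0; have W0 := W_gt0 k0 w01.
set a := gamma0 k w; set b := gamma1 k w.
have a0 : 0 < a by rewrite /a gamma0E// divr_gt0.
have b0 : 0 < b by rewrite /b gamma1E// divr_gt0.
have [Aw dAw] : (Delta k a b).[w] = 0 /\ (Delta k a b)^`().[w] = 0.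
  by apply/(double_rootP k0 a b w01); rewrite /a /b gamma0E ?gamma1E.
have s0 := slope_gt0 k0 w01 Aw dAw.
have a01 : 0 < a < 1 by lra.
have b01 : 0 < b < 1 by lra.
(* (1 - w - a) P(w) = (w - b) Q(w), so the two differences have the same sign,
   and their sum 1 - a - b is positive. *)
have wS : b <= w <= 1 - a.
  have p0 : 0 < p.[w] by apply: (P_gt0 k0); lra.
  have q0 : 0 < q.[w] by apply: (Q_gt0 k0); lra.
  have := Aw; rewrite hornerDelta => h; nra.
split; first by split=> //=; lra.
rewrite /=; have [w12|w12|w12] := ltgtP w (1 / 2).
- left; have w02 : 0 < w < 1 / 2 by lra.
  have bw : 0 < b <= w by lra.
  have [y [yw yS Ay dAy hy]] := simple_root_lt k0 w02 a01 bw Aw dAw.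
  exists y, w; split=> //.
  + exact: mup1_deriv.
  + by apply: mup2_deriv => //; apply: (deriv2_neq0 k0 w01 Aw dAw); lra.
  + by move=> z zS /rootP; apply: hy.
(* Mirror image: swapping a and b moves the double root to 1 - w < 1 / 2. *)
- left; have w02 : 0 < 1 - w < 1 / 2 by lra.
  have w01' : 0 < 1 - w < 1 by lra.
  have [Aw' dAw'] : (Delta k b a).[1 - w] = 0 /\ (Delta k b a)^`().[1 - w] = 0.
    apply/(double_rootP k0 b a w01').
    by rewrite T_sym U_sym W_sym /a /b gamma0E ?gamma1E.
  have aw : 0 < a <= 1 - w by lra.
  have [y [yw yS Ay dAy hy]] := simple_root_lt k0 w02 b01 aw Aw' dAw'.
  have yI : 0 <= 1 - y <= 1 by lra.
  have Ay' : (Delta k a b).[1 - y] = 0 by rewrite Delta_swap Ay oppr0.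
  exists (1 - y), w; split=> //.
  + by apply: contraNneq yw => <-; apply/eqP; ring.
  + by rewrite /= wS; split=> //; lra.
  + by apply: mup1_deriv => //; rewrite deriv_Delta_swap.
  + by apply: mup2_deriv => //; apply: (deriv2_neq0 k0 w01 Aw dAw); lra.
  + move=> z zS /rootP Az.
    have zS' : a <= 1 - z <= 1 - b by move: zS => /= zS; lra.
    have Az' : (Delta k b a).[1 - z] = 0 by rewrite Delta_swap Az oppr0.
    by have [e|e] := hy _ zS' Az'; [left|right]; lra.
- right; exists w; split=> //.
  + subst w; apply: mup3_deriv => //; first exact: deriv2_half.
    exact: deriv3_half_neq0.
  + move=> z /= zS /rootP Az; have [zw|zw|//] := ltgtP z w.
      suff : 0 < (Delta k a b).[z] by lra.
      by apply: (Delta_gt0_left k0 w01 Aw dAw); lra.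
    have := Delta_ratio_gt_right k0 w01 Aw dAw (x := w) (y := z).
    rewrite Aw Az !mul0r ltxx => h.
    by suff: false by []; apply: h; lra.
Qed.

End Critical.

(** * Range of the parameter *)

Section Parametrisation.
Context {R : realType} (k : nat).
Hypothesis k0 : (0 < k)%N.
Implicit Types w : R.
Local Notation p := (P R k).
Local Notation W := (Wp R k).
Local Notation T := (@Tp R k).
Local Notation U := (@Up R k).

Lemma gamma0_half : gamma0 k (1 / 2 : R) = gamma1 k (1 / 2).
Proof. by rewrite /gamma0 half1B. Qed.

Lemma gamma1_half : gamma1 k (1 / 2) = gamma_star R k.
Proof.
have p0 : 0 < p.[1 / 2] by apply: (P_gt0 k0); lra.
have eD : 2 * p.[1 / 2] = 1 - 'C(2 * k, k)%:R * (1 / 2 ^+ 2) ^+ k.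
  have := congr1 (horner^~ (1 / 2 : R)) (@Dp_central R k k0).
  rewrite /= hornerDp Q_half hornerD hornerN hornerZ horner_exp hornerM.
  rewrite !hornerD hornerN !hornerC hornerX.
  rewrite (_ : 1 / 2 * (1 - 1 / 2) = 1 / 2 ^+ 2); last by field.
  by lra.
have dp0 : 0 < p^`().[1 / 2].
  rewrite (deriv_P_factor k0) hornerZ pmulr_rgt0 ?(coefP_gt0 k0)// hornerM hornerX.
  by rewrite pmulr_rgt0 ?(Sp_gt0 k half01)//; lra.
have dp : p^`().[1 / 2] = k%:R * 'C(2 * k, k)%:R * (1 / 2 * (1 / 2 ^+ 2) ^+ k.-1).
  rewrite (deriv_P_factor k0) hornerZ hornerM hornerX /Sp horner_exp hornerM.
  rewrite hornerD hornerN hornerC hornerX half1B /coefP.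
  by congr (_ * (_ * _ ^+ _)); field.
rewrite /gamma1 /= half1B /gamma_star natrM.
have C0 : 'C(2 * k, k)%:R != 0 :> R.
  by rewrite pnatr_eq0 -lt0n bin_gt0 leq_pmull.
have kN0 : k%:R != 0 :> R by rewrite pnatr_eq0 gtn_eqF.
have -> : p.[1 / 2] * (p.[1 / 2] + p.[1 / 2]) /
    (p^`().[1 / 2] * p.[1 / 2] + p^`().[1 / 2] * p.[1 / 2])
   = (2 * p.[1 / 2]) / (2 * p^`().[1 / 2]).
  by field; rewrite -mulr2n mulrn_eq0 mulf_eq0 !gt_eqF.
rewrite eD dp exprM !expr_div_n !expr1n.
have -> : (2 ^+ 2) ^+ k = 2 ^+ 2 * (2 ^+ 2) ^+ k.-1 :> R by rewrite -exprS prednK.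
set h := (2 ^+ 2) ^+ _.
have h0 : h != 0 by rewrite !expf_neq0 ?pnatr_eq0.
by field; rewrite C0 h0 kN0.
Qed.

Lemma is_wminP w : is_wmin k w <-> 0 < w < 1 / 2 /\ T.[w] = 0.
Proof.
split=> -[w02 e]; have w01 : 0 < w < 1 by lra.
  move: e => /eqP; rewrite gamma0E// mulf_eq0 invr_eq0 (gt_eqF (W_gt0 k0 w01)) orbF.
  by move=> /eqP.
by split=> //; rewrite gamma0E// e mul0r.
Qed.

Lemma T_half_gt0 : 0 < T.[1 / 2].
Proof. by rewrite -U_sym half1B; apply: (U_gt0 k0); lra. Qed.

Lemma is_wmin_exists_unique : exists! w, is_wmin k w.
Proof.
have T0 : T.[0] = -1.
  rewrite hornerT hornerWp hornerDp (hornerQ k 0) subr0 (@horner_P_0 R k) (horner_P_1 k0).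
  by rewrite (deriv_P_factor k0) hornerZ hornerM hornerX; ring.
have half0 : 0 <= 1 / 2 :> R by lra.
have [|w /andP[w0 w12] /rootP Tw] := @poly_ivt _ T 0 (1 / 2) half0.
  by rewrite T0 oppr_le0 ler01 ltW ?T_half_gt0.
have w0N : w != 0 by apply: contra_eq_neq Tw => ->; rewrite T0 oppr_eq0 oner_eq0.
have w12N : w != 1 / 2 by apply: contra_eq_neq Tw => ->; rewrite gt_eqF ?T_half_gt0.
exists w; split.
  by apply/is_wminP; split=> //; rewrite !lt_neqAle w0 w12 eq_sym w0N w12N.
move=> v /is_wminP[/andP[v0 v12] Tv].
have [wv|vw|//] := ltgtP w v.
  by have := T_lt k0 w0 wv (ltW v12); rewrite Tw Tv ltxx.
by have := T_lt k0 (ltW v0) vw w12; rewrite Tw Tv ltxx.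
Qed.

(** On the left half of the interval, gamma0 is positive exactly beyond wmin. *)
Lemma T_gt0P wmin w : is_wmin k wmin -> 0 < w <= 1 / 2 -> (0 < T.[w]) = (wmin < w).
Proof.
move=> /is_wminP[/andP[m0 m12] Tm] /andP[w0 w12].
have [mw|wm|<-] := ltgtP wmin w.
- by rewrite -Tm T_lt// ltW.
- by apply/negbTE; rewrite -leNgt -Tm ltW// T_lt// ltW.
- by rewrite Tm ltxx.
Qed.

(** The parameters whose pair (gamma0, gamma1) has positive coordinates form the
    interval from wmin to 1 - wmin. *)
Lemma param_rangeP wmin w : is_wmin k wmin ->
  [/\ 0 < w < 1, 0 < T.[w] & 0 < U.[w]] <-> wmin < w < 1 - wmin.
Proof.
move=> hm; have [/andP[m0 m12] _] := hm.
have [w12|w12] := leP w (1 / 2).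
  split=> [[w01 T0 _]|mw].
    by move: T0; rewrite (T_gt0P hm); lra.
  have wI : 0 < w <= 1 / 2 by lra.
  by split; [lra|rewrite (T_gt0P hm) //; lra|exact: U_gt0].
split=> [[w01 _]|mw].
  by rewrite -T_sym (T_gt0P hm); lra.
have wI : 0 < 1 - w <= 1 / 2 by lra.
split; [lra|by rewrite -U_sym; exact: U_gt0|].
by rewrite -T_sym (T_gt0P hm) //; lra.
Qed.

Lemma Gamma_critE wmin : is_wmin k wmin ->
  @Gamma_crit R k =
  [set (gamma0 k w, gamma1 k w) | w in [set w : R | wmin < w < 1 - wmin]].
Proof.
move=> hm; apply/seteqP; split=> [[a b] /(critical_param k0)[w w01 [-> -> T0 U0]]|].
  by exists w => //; apply/(param_rangeP w hm).
by move=> _ [w /(param_rangeP w hm)[w01 T0 U0] <-]; exact: param_critical.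
Qed.

Lemma gamma0_eq_gamma1 w : 0 < w < 1 -> gamma0 k w = gamma1 k w -> w = 1 / 2.
Proof.
move=> w01 e; have WN0 : W.[w]^-1 != 0 by rewrite invr_eq0 gt_eqF ?(W_gt0 k0).
move: e; rewrite gamma0E// gamma1E// => /(mulIf WN0) TU.
have [w12|w12|//] := ltgtP w (1 / 2).
  have := @T_lt_U R k k0 w; rewrite TU ltxx => h.
  by suff: false by []; apply: h; lra.
have := @T_lt_U R k k0 (1 - w); rewrite T_sym U_sym TU ltxx => h.
by suff: false by []; apply: h; lra.
Qed.

End Parametrisation.

Theorem proposition3 (R : realType) (k : nat) (hk : (1 <= k)%N) :
  (exists! wmin : R, is_wmin k wmin) /\
  (forall wmin wmax : R, is_wmin k wmin -> wmax = 1 - wmin ->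
     @Gamma_crit R k =
       [set (gamma0 k w, gamma1 k w) | w in [set w : R | wmin < w < wmax]]) /\
  gamma0 k (1 / 2) = gamma_star R k /\
  gamma1 k (1 / 2) = gamma_star R k /\
  @Gamma_crit R k `&` [set g | g.1 = g.2] = [set (gamma_star R k, gamma_star R k)].
Proof.
have g1 := @gamma1_half R k hk.
split; first exact: is_wmin_exists_unique.
split; first by move=> wmin wmax hm ->; exact: Gamma_critE.
split; first by rewrite gamma0_half.
split; first exact: g1.
apply/seteqP; split=> [[a b] [/(critical_param hk)[w w01 [-> -> _ _]] /= e]|_ ->].
  by rewrite (gamma0_eq_gamma1 hk w01 e) gamma0_half g1.
split=> //; rewrite -{1}g1 -gamma0_half -g1; apply: param_critical => //; first lra.
  exact: T_half_gt0.
by apply: (U_gt0 hk); lra.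
Qed.
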